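(* Let $K$ be an inversive difference field of functions $f(x,t)$ with basic set $\sigma=\{\alpha_1,\alpha_2\}$, $\alpha_1:f(x,t)\mapsto f(x+h,t)$, $\alpha_2:f(x,t)\mapsto f(x,t+h)$ ($h$ a small step), and let $K\{y\}^{\ast}$ be the ring of $\sigma^{\ast}$-polynomials in one $\sigma^{\ast}$-indeterminate $y$ over $K$. The Crank-Nicholson scheme applied to the diffusion equation $\frac{\partial u}{\partial t}=c\,\frac{\partial^2u}{\partial x^2}$ ($c$ a constant), with $y$ standing for $u$, gives an algebraic difference equation of the form $C=0$, where $$C=\alpha_1\alpha_2y+a_1\alpha_1^{-1}\alpha_2y+a_2\alpha_1y+a_3\alpha_2y+a_4\alpha_1^{-1}y+a_5$$ and $a_1,\dots,a_5\in K$ are constants. Then the $\sigma^{\ast}$-polynomial $C$ generates a prime $\sigma^{\ast}$-ideal $[C]^{\ast}$ of $K\{y\}^{\ast}$. With respect to the standard ranking, the $\sigma^{\ast}$-polynomials $C$, $\alpha_1^{-1}C$, $\alpha_2^{-1}C$, $\alpha_1^{-1}\alpha_2^{-1}C$ form a characteristic set of $[C]^{\ast}$, with leaders $\alpha_1\alpha_2y$, $\alpha_1^{-2}\alpha_2y$, $\alpha_1\alpha_2^{-1}y$, $\alpha_1^{-2}\alpha_2^{-1}y$, respectively, and the $\sigma^{\ast}$-dimension polynomial of $[C]^{\ast}$, which expresses the Einstein's strength of the equation $C=0$, is $$\psi_{Crank\text{-}Nicholson}(t)=6t-1.$$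
   Context: All fields have characteristic zero. An inversive difference ($\sigma^{\ast}$-) field $K$ with basic set $\sigma=\{\alpha_1,\alpha_2\}$ is a field with commuting automorphisms $\alpha_1,\alpha_2$; an element $a$ is a constant if $\alpha_1(a)=\alpha_2(a)=a$. $\Gamma$ is the free commutative group generated by $\sigma$. $K\{y\}^{\ast}$ is the polynomial ring over $K$ in the algebraically independent indeterminates (terms) $\gamma y$ ($\gamma\in\Gamma$, $1\cdot y=y$), on which $\Gamma$ acts by extending its action on $K$ with $\beta(\gamma y)=(\beta\gamma)y$. $[C]^{\ast}$ is the ideal generated by $\{\gamma C\mid\gamma\in\Gamma\}$. For $\gamma=\alpha_1^{k_1}\alpha_2^{k_2}$, $\mathrm{ord}\,\gamma=|k_1|+|k_2|$, and $\Gamma(r)=\{\gamma\in\Gamma\mid\mathrm{ord}\,\gamma\le r\}$. The standard ranking: $\alpha_1^{k_1}\alpha_2^{k_2}y\le\alpha_1^{l_1}\alpha_2^{l_2}y$ iff $(|k_1|+|k_2|,|k_1|,|k_2|,k_1,k_2)$ is lexicographically less than or equal to $(|l_1|+|l_2|,|l_1|,|l_2|,l_1,l_2)$. The leader $u_A$ of $A\notin K$ is the greatest term appearing in $A$. A term $v$ is a transform of a term $u$ if $v=\gamma u$ where $\gamma$ and the exponent vectors of $u$ and $v$ all lie in one common orthant of $\mathbb{Z}^2$ (orthants are products of two factors each equal to $\mathbb{N}=\{0,1,\dots\}$ or $\{a\in\mathbb{Z}\mid a\le0\}$; $\gamma=\alpha_1^{k_1}\alpha_2^{k_2}$ is identified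 with $(k_1,k_2)$). $\mathrm{rk}\,A>\mathrm{rk}\,B$ if $A\notin K$ and $B\in K$, or $u_A>u_B$, or $u_A=u_B$ and $\deg_{u_A}A>\deg_{u_A}B$; ranks are equal if leaders and degrees in them coincide. $A$ is reduced with respect to $B$ if $A$ contains no power of a transform of $u_B$ (including $u_B$) with exponent $\ge\deg_{u_B}B$. A set is autoreduced if it is empty, or it is disjoint from $K$ and each element is reduced with respect to all others. Autoreduced sets are finite, written in order of increasing rank; $\{A_1,\dots,A_p\}$ has lower rank than $\{B_1,\dots,B_q\}$ if for some $k\le\min\{p,q\}$, $\mathrm{rk}\,A_i=\mathrm{rk}\,B_i$ for $i<k$ and $\mathrm{rk}\,A_k<\mathrm{rk}\,B_k$, or $p>q$ and $\mathrm{rk}\,A_i=\mathrm{rk}\,B_i$ for $i\le q$. A characteristic set of an ideal is an autoreduced subset of it of lowest rank. The $\sigma^{\ast}$-dimension polynomial of a prime $\sigma^{\ast}$-ideal $P$ of $K\{y\}^{\ast}$ is the unique polynomial $\psi(t)\in\mathbb{Q}[t]$ such that $\psi(r)=\mathrm{tr.deg}_KK(\{\gamma\eta\mid\gamma\in\Gamma(r)\})$ for all sufficiently large $r\in\mathbb{N}$, where $\eta$ is the canonical image of $y$ in the quotient field of $K\{y\}^{\ast}/P$.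
   Formalization: The constants a_1, a_2, a_4 are assumed nonzero, as they are in the Crank-Nicholson scheme; if one of them vanishes, the corresponding stated leader does not appear in its transform of C and the claim is false. *)

(* Defs.v *)
From HB Require Import structures.
From mathcomp Require Import all_boot all_order all_algebra.
From mathcomp Require Import finmap boolp.
From mathcomp Require Import monalg.

Set Implicit Arguments.
Unset Strict Implicit.
Unset Printing Implicit Defensive.

Import Order.TTheory GRing.Theory Num.Theory.
Local Open Scope ring_scope.

(* Polynomials over R in the algebraically independent indeterminates
   indexed by the (possibly infinite) type I. *)
Notation polyring I R := {malg R[{cmonom I}]}.

Section PolynomialRings.
Variable I : choiceType.

Definition indet (R : comNzRingType) (i : I) : polyring I R := << ucm i >>.

(* The value of p under the substitution of b i for the indeterminate i, with
   phi applied to the coefficients. *)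
Definition peval (R S : comNzRingType) (phi : R -> S) (b : I -> S)
    (p : polyring I R) : S :=
  mmap phi (fun m : {cmonom I} => \prod_(i <- finsupp m) b i ^+ m i) p.

Definition ground (R : comNzRingType) (p : polyring I R) : Prop :=
  exists c : R, p = c%:MP.

Definition appears (R : comNzRingType) (i : I) (p : polyring I R) : Prop :=
  exists2 m : {cmonom I}, m \in msupp p & (m i != 0)%N.

Definition degin (R : comNzRingType) (i : I) (p : polyring I R) : nat :=
  (\max_(m <- msupp p) (m : {cmonom I}) i)%N.

End PolynomialRings.

Definition ideal_generated (A : comNzRingType) (S : A -> Prop) : {pred A} :=
  [pred f | `[< exists2 s : seq (A * A),
                  (forall x, x \in s -> S x.2) &
                  f = \sum_(x <- s) x.1 * x.2 >]].

(* idealr_closed includes properness. *)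
Definition prime_ideal (A : comNzRingType) (P : {pred A}) : Prop :=
  idealr_closed P /\ prime_idealr_closed P.

Definition prime_pred (A : comNzRingType) (P : {pred A})
  of prime_ideal P : A -> bool := fun f => f \in P.

Section QuotientField.
Variables (A : comNzRingType) (P : {pred A}) (hP : prime_ideal P).

HB.instance Definition _ := isIdealr.Build A (prime_pred hP) hP.1.
HB.instance Definition _ := isPrimeIdealrClosed.Build A (prime_pred hP) hP.2.

Definition prime_idealr_pred : prime_idealr A := prime_pred hP.

Definition quotient_domain := {ideal_quot prime_idealr_pred}.

HB.instance Definition _ := GRing.ComNzRing.on quotient_domain.

Definition quotient_unit : pred quotient_domain :=
  fun x => `[< exists y, y * x = 1 >].

Definition quotient_inv (x : quotient_domain) : quotient_domain :=
  if pselect (exists y, y * x = 1) is left e then projT1 (cid e) else x.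

Lemma quotient_mulVr :
  {in quotient_unit, left_inverse 1 quotient_inv *%R}.
Proof.
move=> x /asboolP ux; rewrite /quotient_inv.
by case: pselect => // e; case: (cid e).
Qed.

Lemma quotient_unitP (x y : quotient_domain) :
  y * x = 1 -> quotient_unit x.
Proof. by move=> yx; apply/asboolP; exists y. Qed.

Lemma quotient_inv_out : {in [predC quotient_unit], quotient_inv =1 id}.
Proof.
move=> x /asboolPn nux; rewrite /quotient_inv.
by case: pselect.
Qed.

HB.instance Definition _ := GRing.ComNzRing_hasMulInverse.Build
  quotient_domain quotient_mulVr quotient_unitP quotient_inv_out.

HB.instance Definition _ := GRing.ComUnitRing_isIntegral.Build
  quotient_domain (@Quotient.rquot_IdomainAxiom A prime_idealr_pred).

Definition quotient_field : fieldType := {fraction quotient_domain}.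

Definition to_quotient_field (f : A) : quotient_field :=
  FracField.tofrac (\pi_{ideal_quot prime_idealr_pred}%qT f : quotient_domain).

End QuotientField.

Section TranscendenceDegree.
(* L is an extension of F via iota. *)
Variables (F L : fieldType) (iota : F -> L).

(* The subfield F(X) of L. *)
Definition adjoin (X : L -> Prop) : L -> Prop := fun x =>
  forall S : {pred L}, divring_closed S ->
    (forall c, iota c \in S) -> (forall y, X y -> y \in S) -> x \in S.

Definition alg_independent (d : nat) (b : 'I_d -> L) : Prop :=
  forall p : polyring 'I_d F, peval iota b p = 0 -> p = 0.

Definition algebraic_over (E : L -> Prop) (x : L) : Prop :=
  exists p : {poly L}, [/\ p != 0, forall i, E p`_i & root p x].

(* tr.deg_F F(X) = d: F(X) has a transcendence basis of d elements. *)
Definition trdeg_is (X : L -> Prop) (d : nat) : Prop :=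
  exists b : 'I_d -> L,
    [/\ forall i, adjoin X (b i),
        alg_independent b &
        forall x, adjoin X x ->
          algebraic_over (adjoin (fun y => exists i, y = b i)) x].

End TranscendenceDegree.

Record automorphism (K : fieldType) := Automorphism {
  aut :> {rmorphism K -> K};
  autV : K -> K;
  autK : cancel aut autV;
  autVK : cancel autV aut }.

Definition autz (K : fieldType) (a : automorphism K) (k : int) : K -> K :=
  match k with
  | Posz n => iter n a
  | Negz n => iter n.+1 (autV a)
  end.

Record inversiveDifferenceField := InversiveDifferenceField {
  idf_field :> fieldType;
  alpha1 : automorphism idf_field;
  alpha2 : automorphism idf_field;
  alphaC : forall x, alpha1 (alpha2 x) = alpha2 (alpha1 x) }.

(* The free commutative group on alpha1, alpha2, written additively:
   alpha1^k1 alpha2^k2 is (k1, k2). *)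
Notation Gamma := (int * int)%type.

Definition ordG (g : Gamma) : nat := (`|g.1| + `|g.2|)%N.

Definition rank_key (g : Gamma) : seqlexi int :=
  [:: (ordG g)%:Z; `|g.1|%N%:Z; `|g.2|%N%:Z; g.1; g.2].

(* The standard ranking; the term gamma y is identified with gamma. *)
Definition term_le (u v : Gamma) : bool := (rank_key u <= rank_key v)%O.
Definition term_lt (u v : Gamma) : bool := (rank_key u < rank_key v)%O.

(* The orthants of Z^2 are indexed by pairs of signs. *)
Definition in_orthant (e : bool * bool) (g : Gamma) : bool :=
  (if e.1 then 0 <= g.1 else g.1 <= 0) && (if e.2 then 0 <= g.2 else g.2 <= 0).

Definition transform (u v : Gamma) : Prop :=
  exists g : Gamma, v = g + u /\
    exists e, [/\ in_orthant e g, in_orthant e u & in_orthant e v].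

Section SigmaPolynomials.
Variable K : inversiveDifferenceField.

Definition is_constant (a : K) : Prop := alpha1 K a = a /\ alpha2 K a = a.

Definition actK (g : Gamma) (a : K) : K :=
  autz (alpha1 K) g.1 (autz (alpha2 K) g.2 a).

(* K{y}^*; the indeterminate with index gamma is the term gamma y. *)
Local Notation sigmaPoly := (polyring Gamma K).

Definition term (g : Gamma) : sigmaPoly := indet K g.

Definition act (g : Gamma) : sigmaPoly -> sigmaPoly :=
  peval (fun c : K => (actK g c)%:MP) (fun v => term (g + v)).

Definition sigma_ideal (f : sigmaPoly) : {pred sigmaPoly} :=
  ideal_generated (fun h => exists g, h = act g f).

Definition sigma_closed (P : {pred sigmaPoly}) : Prop :=
  forall g f, f \in P -> act g f \in P.

Definition is_leader (f : sigmaPoly) (u : Gamma) : Prop :=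
  appears u f /\ forall v, appears v f -> term_le v u.

Definition rk_lt (f h : sigmaPoly) : Prop :=
  (ground f /\ ~ ground h) \/
  exists u v, [/\ is_leader f u, is_leader h v &
    term_lt u v \/ (u = v /\ (degin u f < degin v h)%N)].

Definition rk_eq (f h : sigmaPoly) : Prop :=
  exists u, [/\ is_leader f u, is_leader h u & degin u f = degin u h].

Definition reduced (f h : sigmaPoly) : Prop :=
  forall u, is_leader h u ->
    ~ exists v (m : {cmonom Gamma}), [/\ transform u v, m \in msupp f & (degin u h <= m v)%N].

Definition autoreduced (S : {pred sigmaPoly}) : Prop :=
  (forall f, f \in S -> ~ ground f) /\
  (forall f h, f \in S -> h \in S -> f <> h -> reduced f h).

Definition increasing (s : seq sigmaPoly) : Prop :=
  forall i j, (i < j < size s)%N -> rk_lt (nth 0 s i) (nth 0 s j).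

(* Comparison of autoreduced sets listed in increasing order of rank. *)
Definition lower_rank (s t : seq sigmaPoly) : Prop :=
  (exists k, [/\ (k < minn (size s) (size t))%N,
     forall i, (i < k)%N -> rk_eq (nth 0 s i) (nth 0 t i) &
     rk_lt (nth 0 s k) (nth 0 t k)]) \/
  ((size t < size s)%N /\
     forall i, (i < size t)%N -> rk_eq (nth 0 s i) (nth 0 t i)).

(* Since autoreduced sets are finite and their elements have pairwise distinct
   ranks, the lists t below run over all autoreduced subsets of J. *)
Definition characteristic_set (J S : {pred sigmaPoly}) : Prop :=
  [/\ autoreduced S, {subset S <= J} &
    exists s : seq sigmaPoly, [/\ s =i S, increasing s &
      forall t : seq sigmaPoly, autoreduced (mem t) -> {subset t <= J} ->
        increasing t -> ~ lower_rank t s]].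

Section DimensionPolynomial.
Variables (P : {pred sigmaPoly}) (hP : prime_ideal P).

Definition embedK (c : K) : quotient_field hP :=
  to_quotient_field hP c%:MP.

(* gamma eta, where eta is the canonical image of y in the quotient field. *)
Definition generic_zero (g : Gamma) : quotient_field hP :=
  to_quotient_field hP (term g).

Definition dimension_polynomial (psi : {poly rat}) : Prop :=
  exists r0 : nat, forall r : nat, (r0 <= r)%N ->
    exists2 d : nat,
      trdeg_is embedK (fun x => exists2 g, (ordG g <= r)%N & x = generic_zero g) d &
      psi.[r%:R] = d%:R.

End DimensionPolynomial.

Definition crank_nicholson (a1 a2 a3 a4 a5 : K) : sigmaPoly :=
  term (1, 1) + a1 *: term (-1, 1)
  + a2 *: term (1, 0) + a3 *: term (0, 1)
  + a4 *: term (-1, 0) + a5%:MP.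

End SigmaPolynomials.

(* Main.v *)
Require Import Defs.
From HB Require Import structures.
From mathcomp Require Import all_boot all_order all_algebra.
From mathcomp Require Import finmap boolp zify ring.
From mathcomp Require mpoly.
From mathcomp Require Import monalg.

Set Implicit Arguments.
Unset Strict Implicit.
Unset Printing Implicit Defensive.

Import Order.TTheory GRing.Theory Num.Theory.
Local Open Scope ring_scope.

(** Since the coefficients are constants, every transform [gamma C] is the same
five-term affine relation translated by [gamma].  Call cross the set of terms with
[k1 = 0], [k1 = -1] or [k2 = 0].  The leader of each relation lies outside the
cross and has coefficient 1, [a1], [a2] or [a4] according to the quadrant of
[gamma], and each term outside the cross is the leader of exactly one relation.
Solving for the leaders one after the other therefore sends every term to an
affine combination of terms of the cross, and the substitution obtained in this
way is an endomorphism of the polynomial ring with kernel [C]*, which is the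
identity on polynomials in the terms of the cross.  So [C]* is prime, each of its
nonzero elements contains a transform of one of the four leaders, and the terms
of order at most [r] in the cross, of which there are
[(2r + 1) + 2r + 2(r - 1) = 6r - 1], form a transcendence basis. *)

(** * Polynomial rings in arbitrarily many indeterminates *)

Section Peval.
Variables (I : choiceType) (R S : comNzRingType).
Implicit Types (b : I -> S) (m : {cmonom I}) (p q : polyring I R).

Definition monom_eval b m : S := \prod_(i <- finsupp m) b i ^+ m i.

Lemma monom_evalEw (d : {fset I}) b m : (finsupp m `<=` d)%fset ->
  monom_eval b m = \prod_(i <- d) b i ^+ m i.
Proof.
move=> le_d; apply: big_fset_incl => // i _.
by rewrite -cmE_eq0 => /eqP ->.
Qed.

Lemma monom_eval_mmorphism b : mmorphism (monom_eval b).
Proof.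
split=> [m1 m2 | ]; last by rewrite /monom_eval mdom1 big_seq_fset0.
pose d := (finsupp m1 `|` finsupp m2)%fset.
rewrite (@monom_evalEw d) ?mdomD // (@monom_evalEw d b m1) ?fsubsetUl //.
rewrite (@monom_evalEw d b m2) ?fsubsetUr // -big_split /=.
by apply: eq_bigr => i _; rewrite cmM exprD.
Qed.

HB.instance Definition _ b :=
  isMultiplicative.Build {cmonom I} S (monom_eval b) (monom_eval_mmorphism b).

Lemma monom_evalU b i : monom_eval b (ucm i) = b i.
Proof. by rewrite /monom_eval mdomU big_seq_fset1 cmUU expr1. Qed.

Variable phi : {rmorphism R -> S}.

HB.instance Definition _ b :=
  GRing.isZmodMorphism.Build (polyring I R) S (peval phi b)
    (mmap_is_additive (f := phi) (h := monom_eval b)).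

Lemma peval_is_monoid_morphism b : monoid_morphism (peval phi b).
Proof.
have [mulh h1] := mmap_is_multiplicative (f := phi) (h := monom_eval b).
by split.
Qed.

HB.instance Definition _ b :=
  GRing.isMonoidMorphism.Build (polyring I R) S (peval phi b)
    (peval_is_monoid_morphism b).

Lemma pevalC b c : peval phi b c%:MP = phi c.
Proof. exact: (mmapC (f := phi) (h := monom_eval b)). Qed.

Lemma pevalX b i : peval phi b (indet R i) = b i.
Proof.
by rewrite /peval /indet mmapU /= rmorph1 mul1r -/(monom_eval b (ucm i)) monom_evalU.
Qed.

Lemma pevalZ b c p : peval phi b (c *: p) = phi c * peval phi b p.
Proof. by rewrite -mul_malgC rmorphM /= pevalC. Qed.

(** Only the indeterminates that occur in [p] matter. This locality makes polynomials in the cross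
    fixed by the reduction, and lets a single [p] be moved into finitely many variables. *)
Lemma peval_eq (phi' : {rmorphism R -> S}) b b' p : phi =1 phi' ->
  (forall i, appears i p -> b i = b' i) -> peval phi b p = peval phi' b' p.
Proof.
move=> eq_phi eq_b; rewrite /peval !mmapE big_seq [RHS]big_seq.
apply: eq_bigr => m pm; rewrite eq_phi; congr (_ * _).
rewrite big_seq [RHS]big_seq; apply: eq_bigr => i mi; rewrite eq_b //.
by exists m; rewrite ?cmE_neq0.
Qed.

End Peval.

Lemma peval_comp (I : choiceType) (R S T : comNzRingType)
    (phi : {rmorphism R -> S}) (h : {rmorphism S -> T}) (b : I -> S)
    (p : polyring I R) :
  h (peval phi b p) = peval (h \o phi) (h \o b) p.
Proof.
rewrite /peval !mmapE rmorph_sum /=; apply: eq_bigr => m _.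
rewrite rmorphM rmorph_prod /=; congr (_ * _).
by apply: eq_bigr => i _; rewrite rmorphXn.
Qed.

Lemma indet_prod (I : choiceType) (R : comNzRingType) (m : {cmonom I}) :
  \prod_(i <- finsupp m) indet R i ^+ m i = << m >>.
Proof.
have mulU : {morph (fun m1 : {cmonom I} => << m1 >> : polyring I R) :
    m1 m2 / mmul m1 m2 >-> m1 * m2}.
  by move=> m1 m2; rewrite malgM_def fgmulUU mulr1.
(* Each power becomes a product of [m i] copies, so that [mulU] can collect the whole product into
   one monomial. *)
under eq_bigr => i _ do rewrite -[m i]card_ord -prodr_const /indet
  -(big_morph (fun m1 : {cmonom I} => << m1 >> : polyring I R) mulU erefl).
rewrite -(big_morph (fun m1 : {cmonom I} => << m1 >> : polyring I R) mulU erefl).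
congr << _ >>; apply/eqP/cmP => j.
rewrite (big_morph (fun m1 : {cmonom I} => m1 j) (cmM j) (cm1 j)).
have cmU_sum i : (\big[mmul/mone]_(k in 'I_(m i)) ucm i : {cmonom I}) j =
    (if i == j then m i else 0)%N.
  rewrite (big_morph (fun m1 : {cmonom I} => m1 j) (cmM j) (cm1 j)).
  rewrite sum_nat_const card_ord cmU.
  by case: eqP; rewrite ?muln1 ?muln0.
under eq_bigr => i _ do rewrite cmU_sum.
rewrite -big_mkcond /= -big_filter.
have [mj|mj] := boolP (j \in finsupp m).
  rewrite filter_pred1_uniq ?fset_uniq // big_seq1 //.
move: (mj); rewrite -cmE_eq0 => /eqP ->.
by rewrite big_filter big1_seq // => i /andP[/eqP-> jm]; rewrite jm in mj.
Qed.

Lemma peval_id (I : choiceType) (R : comNzRingType) (p : polyring I R) :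
  peval malgC (indet R) p = p.
Proof.
rewrite {2}[p]monalgE /peval mmapE; apply: eq_bigr => m _.
by rewrite indet_prod malgM_def fgmulUU mul1m mulr1.
Qed.

Section PolyringDomain.
Import mpoly.
Import monalg.

(* Restriction to the finitely many indeterminates in d lands in a polynomial
   ring that is known to be a domain. *)
Lemma polyring_mulf_eq0 (I : choiceType) (R : idomainType)
    (p q : polyring I R) : p * q = 0 -> p = 0 \/ q = 0.
Proof.
pose vars (f : polyring I R) : seq I :=
  flatten [seq enum_fset (finsupp m) | m : {cmonom I} <- msupp f].
pose s := vars p ++ vars q.
pose n := size s.
have varsP f i : appears i f -> i \in vars f.
  case=> m fm mi; apply/flattenP; exists (enum_fset (finsupp m)).
    by apply: map_f.
  by rewrite -[_ \in _]cmE_neq0.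
(* An indeterminate outside [s] has index [n] and goes to the extra last variable, which [b'] sends
   to the default 0. *)
pose b i : mpoly.mpoly n.+1 R := 'X_(inord (index i s)).
pose to_mpoly : {rmorphism polyring I R -> mpoly.mpoly n.+1 R} :=
  peval (@mpoly.mpolyC n.+1 R) b.
pose b' (k : 'I_n.+1) := nth 0 [seq indet R i | i <- s] k.
pose of_mpoly : {rmorphism mpoly.mpoly n.+1 R -> polyring I R} :=
  mpoly.mmap (@malgC _ R) b'.
have of_mpolyC c : of_mpoly (mpoly.mpolyC n.+1 c) = c%:MP.
  by rewrite /of_mpoly /= mpoly.mmapC.
have of_mpolyX (i : I) : i \in s -> of_mpoly (b i) = indet R i.
  move=> si; rewrite /of_mpoly /b /= mpoly.mmapX mpoly.mmap1U /b'.
  have lt_i : (index i s < n)%N by rewrite index_mem.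
  by rewrite inordK ?(leq_trans lt_i) // (nth_map i) ?nth_index.
have toK f : {subset vars f <= s} -> of_mpoly (to_mpoly f) = f.
  move=> sf; rewrite /to_mpoly peval_comp -[RHS]peval_id.
  apply: peval_eq => [c|i fi]; first exact: of_mpolyC.
  by apply: of_mpolyX; apply/sf/varsP.
(* By [toK], [to_mpoly] has a left inverse on polynomials in [s], so a zero factor on the finite
   side comes from a zero factor here. *)
move=> pq0; have /eqP : to_mpoly p * to_mpoly q = 0.
  by rewrite -rmorphM pq0 rmorph0.
rewrite mulf_eq0 => /orP[]/eqP f0; [left|right].
  rewrite -[p]toK ?f0 ?rmorph0 // => i pi. 
  by rewrite mem_cat pi.
rewrite -[q]toK ?f0 ?rmorph0 // => i qi. 
by rewrite mem_cat qi orbT.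
Qed.

End PolyringDomain.

(** * The lattice of terms *)

Ltac lia_if := simpl; repeat (match goal with
  |- context [if ?b then _ else _] =>
    lazymatch b with
    | context [if _ then _ else _] => fail
    | _ => let H := fresh in destruct b eqn:H
    end
  end; simpl); lia.

(** The column -1 is included because leaders of translates with [g.1 < 0] start at column -2; in
    the vertical direction only row 0 is skipped. *)
Definition irreducible_term (v : Gamma) : bool :=
  [|| v.1 == 0, v.1 == -1 | v.2 == 0].

(* The leader of the translate of C by g, one case per quadrant. *)
Definition lead (g : Gamma) : Gamma :=
  (if 0 <= g.1 then g.1 + 1 else g.1 - 1, if 0 <= g.2 then g.2 + 1 else g.2).

Definition unlead (v : Gamma) : Gamma :=
  (if 0 < v.1 then v.1 - 1 else v.1 + 1, if 0 < v.2 then v.2 - 1 else v.2).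

Definition stencil : seq Gamma := [:: (1, 1); (-1, 1); (1, 0); (0, 1); (-1, 0)].

(* The columns -1 and 0 both count 0, so that both [a - 2] and [a + 2] are closer
   to the cross than [a] on the appropriate side; the order of a term does not
   have this property. *)
Definition height (v : Gamma) : nat :=
  (`|v.2| + (if (0 <= v.1)%R then `|v.1| else `|v.1|.-1))%N.

Lemma lead_reducible g : ~~ irreducible_term (lead g).
Proof. by case: g => a b; rewrite /irreducible_term /lead /=; lia_if. Qed.

Lemma leadK : cancel lead unlead.
Proof. by case=> a b; rewrite /lead /unlead /=; congr (_, _); lia_if. Qed.

Lemma unleadK v : ~~ irreducible_term v -> lead (unlead v) = v.
Proof.
case: v => a b; rewrite /irreducible_term /lead /unlead /= => ab.
by congr (_, _); lia_if.
Qed.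

Lemma lead_stencil g : lead g - g \in stencil.
Proof.
case: g => a b; rewrite /lead /stencil !inE /= /eq_op /=; lia_if.
Qed.

Lemma stencil_ind (P : Gamma -> Prop) :
  P (1, 1) -> P (-1, 1) -> P (1, 0) -> P (0, 1) -> P (-1, 0) ->
  {in stencil, forall e, P e}.
Proof.
move=> p1 p2 p3 p4 p5 e; rewrite !inE.
by do 4![case/orP => [/eqP-> //|]] => /eqP ->.
Qed.

(** Each coordinate of the leader is the one farthest from the cross, strictly so among the columns
    and among the rows of the translate. Another term differs in some coordinate, hence drops; this
    makes solving for leaders terminate. *)
Lemma height_stencil g e : e \in stencil -> g + e != lead g ->
  (height (g + e)%R < height (lead g))%N.
Proof.
case: g => a b; move: e; apply: stencil_ind;
  rewrite /lead /height /= /eq_op /=; lia_if.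
Qed.

(** Solving for a leader of order at most r thus stays within order r, which the transcendence
    degree requires. *)
Lemma ordG_stencil g e : e \in stencil -> (ordG (g + e)%R <= ordG (lead g))%N.
Proof.
by case: g => a b; move: e; apply: stencil_ind; rewrite /lead /ordG /=; lia_if.
Qed.

(** The lexicographic comparison is unfolded into arithmetic that [lia] can decide. *)
Lemma term_leE u v : term_le u v =
  [|| (ordG u < ordG v)%N |
   (ordG u == ordG v) && [|| (`|u.1| < `|v.1|)%N |
   (`|u.1|%N == `|v.1|%N) && [|| (`|u.2| < `|v.2|)%N |
   (`|u.2|%N == `|v.2|%N) && [|| u.1 < v.1 |
   (u.1 == v.1) && (u.2 <= v.2)]]]].
Proof.
rewrite /term_le /rank_key !Order.SeqLexiOrder.Exports.lexi_cons lexi0s.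
by lia.
Qed.

(** The order alone decides, except when [g.1 = 0]: then columns 1 and -1 tie in all absolute values
    and the sign of [k1] settles it. *)
Lemma term_le_stencil g e : e \in stencil -> term_le (g + e) (lead g).
Proof.
by case: g => a b; move: e; apply: stencil_ind; rewrite term_leE /lead /ordG /=; lia_if.
Qed.

Lemma term_le_anti u v : term_le u v -> term_le v u -> u = v.
Proof.
by case: u v => [a b] [c d]; rewrite !term_leE /ordG /= => uv vu; congr (_, _); lia_if.
Qed.

(** Sharing an orthant means that a nonzero coordinate keeps its sign and can only move away from
    0. *)
Lemma transform_bounds u v : transform u v ->
  [/\ 0 < u.1 -> u.1 <= v.1, u.1 < 0 -> v.1 <= u.1,
      0 < u.2 -> u.2 <= v.2 & u.2 < 0 -> v.2 <= u.2].
Proof.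
case=> -[a b] [-> [[e1 e2]]]; case: u => c d; rewrite /in_orthant /=.
by case: e1 e2 => [] [] [] /andP[] ? ? /andP[] ? ? /andP[] ? ?; split; lia.
Qed.

Lemma transform_le u v : transform u v -> term_le u v.
Proof.
case=> -[a b] [-> [[e1 e2]]]; case: u => c d; rewrite /in_orthant term_leE /ordG /=.
by case: e1 e2 => [] [] [] /andP[] ? ? /andP[] ? ? /andP[] ? ?; lia.
Qed.

(** One translate per quadrant, with leaders (1, -1), (1, 1), (-2, -1), (-2, 1): the listing follows
    increasing rank. *)
Definition corners : seq Gamma := [:: (0, -1); (0, 0); (-1, -1); (-1, 0)].

Lemma corners_ind (P : Gamma -> Prop) :
  P (0, -1) -> P (0, 0) -> P (-1, -1) -> P (-1, 0) -> {in corners, forall g, P g}.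
Proof.
move=> p1 p2 p3 p4 g; rewrite !inE.
by do 3![case/orP => [/eqP-> //|]] => /eqP ->.
Qed.

(** The four other terms of a corner relation lie in the cross, while transforms of a corner leader
    stay off the cross and in its quadrant. *)
Lemma corners_reduced : {in corners &, forall g h, {in stencil, forall e,
  transform (lead h) (g + e) -> g = h}}.
Proof.
move=> g h gc; move: g gc h; apply: corners_ind; apply: corners_ind;
  apply: stencil_ind => /transform_bounds[] /=; rewrite /lead //=; lia.
Qed.

(** The complement of the cross is the union of four translated quadrants whose apexes are the
    corner leaders. *)
Lemma reducible_transform v : ~~ irreducible_term v ->
  exists2 g, g \in corners & transform (lead g) v.
Proof.
case: v => a b; rewrite /irreducible_term /= => ab.
pose g : Gamma := (if 0 < a then 0 else -1, if 0 < b then 0 else -1).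
exists g; first by rewrite /g; do 2!case: ifP.
exists ((a, b) - lead g); split; first by rewrite subrK.
exists (0 < a, 0 < b); rewrite /in_orthant /g /lead /=.
by split; lia_if.
Qed.

(** * Normal forms and the ideal of the scheme *)

Section GeneratedIdeal.
Variables (A : comNzRingType) (S : A -> Prop).
Local Notation J := (ideal_generated S).

Lemma ideal_generated_incl f : S f -> f \in J.
Proof.
move=> Sf; apply/asboolP; exists [:: (1, f)].
  by move=> x; rewrite inE => /eqP ->.
by rewrite big_seq1 mul1r.
Qed.

Lemma ideal_generated0 : 0 \in J.
Proof. by apply/asboolP; exists [::]; rewrite ?big_nil. Qed.

Lemma ideal_generatedD f h : f \in J -> h \in J -> f + h \in J.
Proof.
move=> /asboolP[s sS ->] /asboolP[t tS ->]; apply/asboolP; exists (s ++ t).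
  by move=> x; rewrite mem_cat => /orP[/sS|/tS].
by rewrite big_cat.
Qed.

Lemma ideal_generatedMl a f : f \in J -> a * f \in J.
Proof.
move=> /asboolP[s sS ->]; apply/asboolP; exists [seq (a * x.1, x.2) | x <- s].
  by move=> x /mapP[y /sS ? ->].
by rewrite big_map mulr_sumr; apply: eq_bigr => x _; rewrite mulrA.
Qed.

Lemma ideal_generatedN f : f \in J -> - f \in J.
Proof. by rewrite -mulN1r; apply: ideal_generatedMl. Qed.

Lemma ideal_generatedB f h : f \in J -> h \in J -> f - h \in J.
Proof. by move=> fJ hJ; apply/ideal_generatedD/ideal_generatedN. Qed.

Lemma ideal_generated_sum (T : eqType) (r : seq T) (P : pred T) F :
  (forall x, x \in r -> P x -> F x \in J) -> \sum_(x <- r | P x) F x \in J.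
Proof.
move=> FJ; rewrite big_seq_cond; apply: (big_ind (fun f => f \in J)).
- exact: ideal_generated0.
- exact: ideal_generatedD.
- by move=> x /andP[]; apply: FJ.
Qed.

Lemma ideal_generated_ind (P : A -> Prop) : P 0 ->
  (forall f h, P f -> P h -> P (f + h)) -> (forall a f, S f -> P (a * f)) ->
  forall f, f \in J -> P f.
Proof.
move=> P0 PD PM f /asboolP[s sS ->]; rewrite big_seq.
by apply: big_ind => // x /sS /PM.
Qed.

(** Congruence modulo the ideal is compatible with products; this leads to congruent substitutions
    having congruent values. *)
Lemma ideal_generated_prod (T : Type) (r : seq T) (F G : T -> A) :
  (forall x, F x - G x \in J) ->
  \prod_(x <- r) F x - \prod_(x <- r) G x \in J.
Proof.
move=> FG; elim/big_ind2: _ => [|y x y' x' xy xy'|//].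
  by rewrite subrr ideal_generated0.
rewrite (_ : _ - _ = x' * (x - y) + y * (x' - y')); last by ring.
by apply: ideal_generatedD; apply: ideal_generatedMl.
Qed.

Lemma ideal_generated_peval (I : choiceType) (R : comNzRingType)
    (phi : {rmorphism R -> A}) (b b' : I -> A) (p : polyring I R) :
  (forall i, b i - b' i \in J) -> peval phi b p - peval phi b' p \in J.
Proof.
move=> bb'; rewrite /peval !mmapE -sumrB.
apply: ideal_generated_sum => m _ _; rewrite -mulrBr.
apply/ideal_generatedMl/ideal_generated_prod => i.
by rewrite -[m i]card_ord -!prodr_const; apply: ideal_generated_prod.
Qed.

End GeneratedIdeal.

Section NormalForm.
Variables (F : fieldType) (A : lmodType F) (w : Gamma -> F) (c : A).
Hypothesis w_lead : forall g, w (lead g - g) != 0.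

(** The family [Y] is a parameter so that one formula covers both the translates of C, with [Y] the
    indeterminates, and their images under substitution. *)
Definition scheme (Y : Gamma -> A) (g : Gamma) : A :=
  \sum_(e <- stencil) w e *: Y (g + e) + c.

(** The value that the vanishing of [scheme Y g] forces on [Y (lead g)]. *)
Definition rewrite_lead (Y : Gamma -> A) (g : Gamma) : A :=
  - (w (lead g - g))^-1 *:
    (\sum_(e <- stencil | e != lead g - g) w e *: Y (g + e) + c).

Lemma rewrite_lead_eq Y Y' g :
  (forall v, (height v < height (lead g))%N -> Y v = Y' v) ->
  rewrite_lead Y g = rewrite_lead Y' g.
Proof.
move=> YY'; congr (_ *: (_ + _)).
rewrite big_seq_cond [RHS]big_seq_cond; apply: eq_bigr => e /andP[es ne].
rewrite YY' // height_stencil //.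
by apply: contra_neq ne => <-; rewrite addrC addKr.
Qed.

Lemma scheme_eq0 Y g : (scheme Y g == 0) = (Y (lead g) == rewrite_lead Y g).
Proof.
rewrite /scheme (bigD1_seq (lead g - g)) ?lead_stencil //=.
rewrite [X in Y X]addrC subrK -addrA addr_eq0 /rewrite_lead scaleNr.
apply/eqP/eqP => [E | ->]; last by rewrite scalerN scalerA mulfV ?scale1r.
by rewrite -scalerN -E scalerA mulVf ?scale1r.
Qed.

(** When [Y'] solves the relation, the discrepancy at the leader is controlled by the relation
    itself and by discrepancies at lower terms: the inductive step for comparing terms with their
    normal forms. *)
Lemma scheme_diff Y Y' g : scheme Y' g = 0 ->
  Y (lead g) - Y' (lead g) = (w (lead g - g))^-1 *: (scheme Y g -
    \sum_(e <- stencil | e != lead g - g) w e *: (Y (g + e) - Y' (g + e))).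
Proof.
move=> Y'0; have -> : scheme Y g =
    \sum_(e <- stencil) w e *: (Y (g + e) - Y' (g + e)).
  rewrite -[LHS]subr0 -[X in _ - X]Y'0 /scheme opprD addrACA subrr addr0 -sumrB.
  by apply: eq_bigr => e _; rewrite scalerBr.
rewrite (bigD1_seq (lead g - g)) ?lead_stencil //= addrK.
by rewrite scalerA mulVf // scale1r [g + _]addrC subrK.
Qed.

Variable init : Gamma -> A.

(* [n] is fuel: any [n] larger than the height of [v] gives the same value. *)
Fixpoint nf_rec n (v : Gamma) : A :=
  if irreducible_term v then init v else
  if n is n'.+1 then rewrite_lead (nf_rec n') (unlead v) else 0.

Definition normal_form v := nf_rec (height v).+1 v.

Lemma nf_recS n v : nf_rec n.+1 v =
  if irreducible_term v then init v else rewrite_lead (nf_rec n) (unlead v).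
Proof. by []. Qed.

Lemma nf_recE n m v : (height v < n)%N -> (height v < m)%N ->
  nf_rec n v = nf_rec m v.
Proof.
elim: n m v => [|n IHn] m v; first by rewrite ltn0.
case: m => [|m]; first by rewrite ltn0.
rewrite !ltnS => vn vm; rewrite !nf_recS.
case: (boolP (irreducible_term v)) => // /unleadK lead_v.
apply: rewrite_lead_eq => u; rewrite lead_v => lt_uv.
by apply: IHn; apply: leq_trans lt_uv _.
Qed.

Lemma normal_form_irreducible v : irreducible_term v -> normal_form v = init v.
Proof. by rewrite /normal_form nf_recS => ->. Qed.

(** The relation at [g] holds by construction: [lead g] is off the cross, [unlead] returns [g], and
    so this relation is the one that defines the normal form of [lead g]. *)
Lemma scheme_normal_form g : scheme normal_form g = 0.
Proof.
apply/eqP; rewrite scheme_eq0; apply/eqP.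
rewrite {1}/normal_form nf_recS (negbTE (lead_reducible g)) leadK.
by apply: rewrite_lead_eq => v lt_v; apply: nf_recE.
Qed.

Lemma lead_ind (P : Gamma -> Prop) :
  (forall v, irreducible_term v -> P v) ->
  (forall g, {in stencil, forall e, e != lead g - g -> P (g + e)} ->
    P (lead g)) ->
  forall v, P v.
Proof.
move=> P0 Plead v; have [n] := ubnP (height v); elim: n v => // n IHn v.
rewrite ltnS => le_vn; have [/P0 //|/unleadK lead_v] := boolP (irreducible_term v).
rewrite -lead_v; apply: Plead => e es ne; apply: IHn.
apply: leq_trans le_vn; rewrite -{2}lead_v height_stencil //.
by apply: contra_neq ne => <-; rewrite addrC addKr.
Qed.

End NormalForm.

Section SchemeIdeal.
Variables (F : fieldType) (w : Gamma -> F) (c : F).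
Hypothesis w_lead : forall g, w (lead g - g) != 0.

Local Notation A := (polyring Gamma F).
Local Notation C := (scheme w (c%:MP : A) (@indet Gamma F)).
Local Notation J := (ideal_generated (fun h : A => exists g, h = C g)).
Local Notation nf := (normal_form w (c%:MP : A) (@indet Gamma F)).

Definition reduction : {rmorphism A -> A} := peval (@malgC _ F) nf.

Lemma reductionX v : reduction (indet F v) = nf v.
Proof. exact: pevalX. Qed.

Lemma reductionZ a f : reduction (a *: f) = a *: reduction f.
Proof. by rewrite /reduction /= pevalZ mul_malgC. Qed.

Lemma reduction_scheme g : reduction (C g) = 0.
Proof.
rewrite -[RHS](scheme_normal_form c%:MP w_lead (@indet Gamma F) g).
rewrite /scheme rmorphD rmorph_sum /=; congr (_ + _); last exact: pevalC.
by apply: eq_bigr => e _; rewrite reductionZ reductionX.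
Qed.

Lemma reduction_irreducible f :
  (forall v, appears v f -> irreducible_term v) -> reduction f = f.
Proof.
move=> irr; rewrite -[RHS]peval_id; apply: peval_eq => // v /irr.
exact: normal_form_irreducible.
Qed.

Lemma indet_sub_normal_form v : indet F v - nf v \in J.
Proof.
elim/lead_ind: v => [v irr|g IH].
  by rewrite normal_form_irreducible // subrr ideal_generated0.
rewrite (scheme_diff w_lead _ (scheme_normal_form _ w_lead _ g)) -mul_malgC.
apply: ideal_generatedMl; apply: ideal_generatedB.
  by apply: ideal_generated_incl; exists g.
apply: ideal_generated_sum => e es ne; rewrite -mul_malgC.
by apply: ideal_generatedMl; apply: IH.
Qed.

(** The reduction kills the generators. Conversely [f] and [reduction f] are values of the same
    polynomial at families congruent modulo [J], so [f - reduction f] lies in [J]. *)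
Lemma mem_scheme_ideal f : f \in J <-> reduction f = 0.
Proof.
split=> [|f0].
  elim/ideal_generated_ind: f / => [|f h f0 h0|a f [g ->]].
  - exact: rmorph0.
  - by rewrite rmorphD f0 h0 addr0.
  - by rewrite rmorphM reduction_scheme mulr0.
rewrite -[f]subr0 -f0 -{1}[f]peval_id.
by apply: ideal_generated_peval => v; apply: indet_sub_normal_form.
Qed.

(** A kernel of an endomorphism of a domain is prime; properness holds because the reduction fixes
    1. *)
Lemma scheme_ideal_prime : prime_ideal J.
Proof.
split; first split.
- exact: ideal_generated0.
- apply/negP => /mem_scheme_ideal /eqP; rewrite rmorph1.
  by rewrite oner_eq0.
- move=> a u v uJ vJ; apply: ideal_generatedD => //.
  exact: ideal_generatedMl.
move=> u v /mem_scheme_ideal; rewrite rmorphM.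
by case/polyring_mulf_eq0 => /mem_scheme_ideal ->; rewrite ?orbT.
Qed.

(** A polynomial in cross terms alone is fixed by the reduction, which kills [J]. *)
Lemma scheme_ideal_reducible f : f \in J -> f != 0 ->
  exists2 v, appears v f & ~~ irreducible_term v.
Proof.
move=> /mem_scheme_ideal f0 nz_f; apply: contrapT => irr.
case/eqP: nz_f; rewrite -f0 reduction_irreducible // => v fv.
by apply/negPn/negP => nv; apply: irr; exists v.
Qed.

Lemma mcoeff_scheme g m : (C g)@_m =
  \sum_(e <- stencil) w e * (ucm (g + e)%R == m)%:R + c *+ (m == mone).
Proof.
rewrite mcoeffD mcoeffC raddf_sum /=; congr (_ + _).
by apply: eq_bigr => e _; rewrite mcoeffZ /indet mcoeffU1.
Qed.

Lemma msupp_scheme g m : m \in msupp (C g) ->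
  m = mone \/ exists2 e, e \in stencil & m = ucm (g + e)%R.
Proof.
rewrite -mcoeff_neq0 mcoeff_scheme => nz.
have [->|nm] := eqVneq m mone; [by left | right].
apply: contrapT => out; case/eqP: nz.
rewrite (negbTE nm) addr0 big1_seq // => e /= es.
by case: eqP => [e_m|_]; rewrite ?mulr0 //; case: out; exists e.
Qed.

Lemma appears_scheme g v : appears v (C g) ->
  exists2 e, e \in stencil & v = g + e.
Proof.
case=> m /msupp_scheme[->|[e es ->]]; rewrite ?cm1 // cmU eqb0 negbK => /eqP <-.
by exists e.
Qed.

Lemma ucm_inj (I : choiceType) : injective (@ucm I).
Proof.
move=> i j /(congr1 (fun m : {cmonom I} => m j)); rewrite cmUU cmU.
by case: eqP.
Qed.

(** Distinct stencil points give distinct terms, so nothing cancels the nonzero coefficient of the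
    leader. *)
Lemma lead_in_msupp_scheme g : ucm (lead g) \in msupp (C g).
Proof.
rewrite -mcoeff_neq0 mcoeff_scheme cm1_eq1 addr0.
rewrite (bigD1_seq (lead g - g)) ?lead_stencil //= big1 => [|e ne].
  by rewrite [g + _]addrC subrK eqxx mulr1 addr0 w_lead.
rewrite (inj_eq (@ucm_inj _)); case: eqP => [e_g|_]; rewrite ?mulr0 //.
by rewrite -e_g addrC addKr eqxx in ne.
Qed.

Lemma is_leader_scheme g : appears (lead g) (C g) /\
  forall v, appears v (C g) -> term_le v (lead g).
Proof.
split; first by exists (ucm (lead g)); rewrite ?lead_in_msupp_scheme ?cmUU.
by move=> v /appears_scheme[e es ->]; apply: term_le_stencil.
Qed.

Lemma degin_scheme g : degin (lead g) (C g) = 1%N.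
Proof.
apply/eqP; rewrite eqn_leq; apply/andP; split.
  apply/bigmax_leqP_seq => m /msupp_scheme[->|[e _ ->]] _; rewrite ?cm1 //.
  by rewrite cmU leq_b1.
rewrite -{1}(cmUU (lead g)) /degin.
apply: (@leq_bigmax_seq _ _ xpredT (fun m : {cmonom Gamma} => m (lead g))) => //.
exact: lead_in_msupp_scheme.
Qed.

End SchemeIdeal.

(** * Transcendence degree *)

Definition zrange n : seq int := [seq k%:Z - n%:Z | k <- iota 0 n.*2.+1].

Lemma mem_zrange n z : (z \in zrange n) = (`|z| <= n)%N.
Proof.
apply/mapP/idP => [[k] | z_n]; first by rewrite mem_iota => ? ->; lia.
by exists `|(z + n%:Z)%R|%N; rewrite ?mem_iota; lia.
Qed.

Lemma zrange_uniq n : uniq (zrange n).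
Proof. by rewrite map_inj_uniq ?iota_uniq // => x y; lia. Qed.

Lemma mem_rem0_zrange n z : (z \in rem 0 (zrange n)) = (z != 0) && (`|z| <= n)%N.
Proof. by rewrite (mem_rem_uniq _ (zrange_uniq n)) -mem_zrange. Qed.

(** The two columns omit 0 because their crossings with row 0 are already listed; column -1 spends
    one unit of order on its first coordinate. *)
Definition irreducible_terms r : seq Gamma :=
  [seq (a, 0) | a <- zrange r] ++ [seq (0, b) | b <- rem 0 (zrange r)] ++
  [seq (-1, b) | b <- rem 0 (zrange r.-1)].

Lemma mem_map_pair1 (b a' b' : int) (s : seq int) :
  ((a', b') \in [seq (a, b) | a <- s]) = (a' \in s) && (b' == b).
Proof.
apply/mapP/andP => [[a sa [-> ->]] //|[sa /eqP ->]]; by exists a'.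
Qed.

Lemma mem_map_pair2 (a a' b' : int) (s : seq int) :
  ((a', b') \in [seq (a, b) | b <- s]) = (a' == a) && (b' \in s).
Proof.
apply/mapP/andP => [[b sb [-> ->]] //|[/eqP -> sb]]; by exists b'.
Qed.

Lemma mem_irreducible_terms r v : (0 < r)%N ->
  (v \in irreducible_terms r) = irreducible_term v && (ordG v <= r)%N.
Proof.
case: v => a b r_gt0; rewrite !mem_cat mem_map_pair1 !mem_map_pair2.
rewrite !mem_rem0_zrange mem_zrange.
rewrite /irreducible_term /ordG /=; lia.
Qed.

Lemma irreducible_terms_uniq r : uniq (irreducible_terms r).
Proof.
have uniq1 n : uniq [seq (a, 0 : int) | a <- zrange n].
  by rewrite map_inj_uniq ?zrange_uniq // => x y [].
have uniq2 n (a : int) : uniq [seq (a, b) | b <- rem 0 (zrange n)].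
  by rewrite map_inj_uniq ?rem_uniq ?zrange_uniq // => x y [].
rewrite !cat_uniq uniq1 !uniq2 !andTb andbT.
by apply/andP; split; apply/hasPn => -[a b];
  rewrite ?mem_cat ?mem_map_pair1 ?mem_map_pair2 ?mem_rem0_zrange; lia.
Qed.

(** At r = 0 the list has one term, whereas [6 * r - 1] truncates to 0. *)
Lemma size_irreducible_terms r : (0 < r)%N ->
  size (irreducible_terms r) = (6 * r - 1)%N.
Proof.
move=> r_gt0; rewrite !size_cat !size_map !size_rem ?mem_zrange //.
by rewrite !size_map !size_iota; lia.
Qed.

Section DivringClosed.
Variables (L : fieldType) (S : {pred L}).
Hypothesis S_closed : GRing.divring_closed S.

Lemma divring0 : 0 \in S.
Proof. by case: S_closed => S1 SB _; rewrite -(subrr 1) SB. Qed.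

Lemma divringN x : x \in S -> - x \in S.
Proof. by case: S_closed => S1 SB _ Sx; rewrite -sub0r SB ?divring0. Qed.

Lemma divringD x y : x \in S -> y \in S -> x + y \in S.
Proof.
by case: (S_closed) => S1 SB _ Sx Sy; rewrite -[y]opprK SB // divringN.
Qed.

Lemma divringV x : x \in S -> x^-1 \in S.
Proof. by case: S_closed => S1 _ SV Sx; rewrite -div1r SV. Qed.

Lemma divringM x y : x \in S -> y \in S -> x * y \in S.
Proof.
by case: (S_closed) => S1 _ SV Sx Sy; rewrite -[y]invrK SV // divringV.
Qed.

Lemma divring_sum (T : eqType) (s : seq T) (P : pred T) (f : T -> L) :
  (forall x, x \in s -> P x -> f x \in S) -> \sum_(x <- s | P x) f x \in S.
Proof.
move=> Sf; rewrite big_seq_cond; apply: (big_ind (fun x => x \in S)).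
- exact: divring0.
- exact: divringD.
- by move=> x /andP[]; apply: Sf.
Qed.

End DivringClosed.

Section Adjoin.
Variables (F L : fieldType) (iota : F -> L).

Lemma mem_adjoin (X : L -> Prop) x : X x -> adjoin iota X x.
Proof. by move=> Xx S _ _ SX; apply: SX. Qed.

Lemma adjoin_sub (X Y : L -> Prop) x :
  (forall y, X y -> adjoin iota Y y) -> adjoin iota X x -> adjoin iota Y x.
Proof. by move=> XY Xx S Sc Si SY; apply: Xx => // y /XY; apply. Qed.

(** The chosen basis will generate the whole field, so linear polynomials witness algebraicity. *)
Lemma algebraic_over_adjoin (X : L -> Prop) x :
  adjoin iota X x -> algebraic_over (adjoin iota X) x.
Proof.
move=> Xx; exists ('X - x%:P); split; last by rewrite root_XsubC.
  by rewrite polyXsubC_eq0.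
move=> i S Sc Si SX; have Sx : x \in S by apply: Xx.
rewrite coefB coefX coefC; have [S1 SB _] := Sc.
by apply: SB; case: eqP => _ //; apply: divring0.
Qed.

End Adjoin.

Section TranscendenceDegree.
Variables (F : fieldType) (w : Gamma -> F) (c : F).
Hypothesis w_lead : forall g, w (lead g - g) != 0.
Local Notation A := (polyring Gamma F).
Local Notation C := (scheme w (c%:MP : A) (@indet Gamma F)).
Local Notation J := (ideal_generated (fun h : A => exists g, h = C g)).

Variables (L : fieldType) (h : {rmorphism A -> L}).
Hypothesis ker_h : forall f, h f = 0 <-> f \in J.

Lemma scheme_relation g :
  \sum_(e <- stencil) h (w e)%:MP * h (indet F (g + e)) + h c%:MP = 0.
Proof.
rewrite -[RHS](proj2 (ker_h (C g))); last first.
  by apply: ideal_generated_incl; exists g.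
rewrite /scheme rmorphD rmorph_sum /=; congr (_ + _).
by apply: eq_bigr => e _; rewrite -mul_malgC rmorphM.
Qed.

(** Induction along the relations: the image of each leader is solved for inside the subfield, from
    terms of no greater order. *)
Lemma adjoin_irreducible r v : (ordG v <= r)%N ->
  adjoin (fun a => h a%:MP)
    (fun x => exists u, [/\ irreducible_term u, (ordG u <= r)%N & x = h (indet F u)])
    (h (indet F v)).
Proof.
move=> + S Sc Si SX; have {}Si a : h a%:MP \in S := Si a.
elim/lead_ind: v => [v irr vr|g IH gr].
  by apply: SX; exists v.
have := scheme_relation g.
rewrite (bigD1_seq (lead g - g)) ?lead_stencil //=.
rewrite [g + (lead g - g)]addrC subrK -addrA => /eqP.
rewrite addr_eq0 => /eqP /(canRL (mulKf _)) ->; last first.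
  by rewrite (fmorph_eq0 (h \o @malgC _ F)).
apply: (divringM Sc); first by apply: (divringV Sc); apply: Si.
apply: (divringN Sc); apply: (divringD Sc); last exact: Si.
apply: (divring_sum Sc) => e es ne; apply: (divringM Sc); first exact: Si.
by apply: IH => //; apply: leq_trans gr; apply: ordG_stencil.
Qed.

(** The images of the cross terms of order at most r form the basis. A relation among them would be
    a polynomial in [J] fixed by the reduction, hence zero. *)
Lemma trdeg_scheme r : (0 < r)%N ->
  trdeg_is (fun a => h a%:MP)
    (fun x => exists2 g, (ordG g <= r)%N & x = h (indet F g)) (6 * r - 1)%N.
Proof.
move=> r_gt0; rewrite -size_irreducible_terms //.
set s := irreducible_terms r; set d := size s.
pose v (i : 'I_d) := nth 0 s i.
have v_s i : irreducible_term (v i) && (ordG (v i) <= r)%N.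
  by rewrite -mem_irreducible_terms // mem_nth.
exists (fun i => h (indet F (v i))); split=> [i|p p0|x Xx].
- by apply: mem_adjoin; exists (v i) => //; case/andP: (v_s i).
- pose q := peval (@malgC _ F) (fun i => indet F (v i)) p.
  have q0 : q = 0.
    have qJ : q \in J by apply/ker_h; rewrite /q peval_comp.
    have <- : reduction w c q = 0 by apply/mem_scheme_ideal.
    rewrite /q peval_comp; apply: peval_eq => [a|i _] /=.
      by rewrite /reduction /= pevalC.
    rewrite reductionX normal_form_irreducible //.
    by case/andP: (v_s i).
  (* Undoes the renaming of basis indices into cross terms, recovering [p] from [q]; other terms go
     to 0. *)
  pose back (u : Gamma) : polyring 'I_d F :=
    if insub (index u s) is Some i then indet F i else 0.
  have <- : peval (@malgC _ F) back q = p; last by rewrite q0 rmorph0.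
  rewrite /q peval_comp -[RHS]peval_id; apply: peval_eq => [a|i _] /=.
    by rewrite pevalC.
  by rewrite pevalX /back index_uniq ?irreducible_terms_uniq // valK.
apply: algebraic_over_adjoin; apply: adjoin_sub Xx => y [g gr ->].
apply: adjoin_sub (adjoin_irreducible gr) => z [u [u_irr ur ->]].
apply: mem_adjoin.
have us : u \in s by rewrite mem_irreducible_terms // u_irr.
have lt_u : (index u s < d)%N by rewrite index_mem.
by exists (Ordinal lt_u); rewrite /v nth_index.
Qed.

End TranscendenceDegree.

Section QuotientMorphism.
Variables (A : comNzRingType) (P : {pred A}) (hP : prime_ideal P).

Lemma to_quotient_field_is_zmod_morphism : zmod_morphism (to_quotient_field hP).
Proof. by move=> x y; rewrite /to_quotient_field !rmorphB. Qed.

Lemma to_quotient_field_is_monoid_morphism :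
  monoid_morphism (to_quotient_field hP).
Proof.
split=> [|x y]; first by rewrite /to_quotient_field !rmorph1.
by rewrite /to_quotient_field !rmorphM.
Qed.

HB.instance Definition _ := GRing.isZmodMorphism.Build A (quotient_field hP)
  (to_quotient_field hP) to_quotient_field_is_zmod_morphism.
HB.instance Definition _ := GRing.isMonoidMorphism.Build A (quotient_field hP)
  (to_quotient_field hP) to_quotient_field_is_monoid_morphism.

Lemma to_quotient_field_eq0 f : to_quotient_field hP f = 0 <-> f \in P.
Proof.
rewrite /to_quotient_field; split=> [/eqP|fP].
  rewrite tofrac_eq0 -(rmorph0 \pi_{ideal_quot prime_idealr_pred hP}%qT).
  by rewrite -Quotient.idealrBE subr0.
suff -> : \pi_{ideal_quot prime_idealr_pred hP}%qT f = 0 by rewrite rmorph0.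
rewrite -(rmorph0 \pi_{ideal_quot prime_idealr_pred hP}%qT).
by apply/eqP; rewrite -Quotient.idealrBE subr0.
Qed.

End QuotientMorphism.

(** * Characteristic set and group action *)

Lemma term_ltNge u v : term_lt u v = ~~ term_le v u.
Proof. by rewrite /term_lt /term_le ltNge. Qed.

Lemma term_le_trans v u u' : term_le u v -> term_le v u' -> term_le u u'.
Proof. exact: le_trans. Qed.

Lemma corners_sorted i j : (i <= j < 4)%N ->
  term_le (lead (nth 0 corners i)) (lead (nth 0 corners j)).
Proof.
by case/andP; do 5?[case: j => [|j] //]; do 5?[case: i => [|i] //];
  rewrite term_leE.
Qed.

Lemma corners_sorted_lt i j : (i < j < 4)%N ->
  term_lt (lead (nth 0 corners i)) (lead (nth 0 corners j)).
Proof.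
by rewrite term_ltNge; case/andP; do 5?[case: j => [|j] //];
  do 5?[case: i => [|i] //]; rewrite term_leE.
Qed.

Lemma degin_gt0 (I : choiceType) (R : comNzRingType) i (f : polyring I R) :
  appears i f -> (0 < degin i f)%N.
Proof.
case=> m fm; rewrite -lt0n => /leq_trans -> //.
exact: (@leq_bigmax_seq _ _ xpredT (fun m : {cmonom I} => m i)).
Qed.

Lemma ground_appears (I : choiceType) (R : comNzRingType) i (f : polyring I R) :
  ground f -> ~ appears i f.
Proof.
case=> c -> [m]; rewrite -mcoeff_neq0 mcoeffC.
by have [->|_] := eqVneq m mone; rewrite ?cm1 // mulr0n eqxx.
Qed.

(** The theorem lists the four elements in another order than that of rank; only membership is
    compared. *)
Lemma map_corners_eqi (T : eqType) (F : Gamma -> T) :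
  [:: F 0; F (-1, 0); F (0, -1); F (-1, -1)] =i [seq F g | g <- corners].
Proof.
move=> x; rewrite /= !inE -[(0, 0)]/(0 : Gamma).
by do 4!case: (x == _).
Qed.

Section CharacteristicSet.
Variables (K : inversiveDifferenceField) (w : Gamma -> K) (c : K).
Hypothesis w_lead : forall g, w (lead g - g) != 0.
Local Notation A := (polyring Gamma K).
Local Notation C := (scheme w (c%:MP : A) (@indet Gamma K)).
Local Notation J := (ideal_generated (fun h : A => exists g, h = C g)).

Implicit Types (f : A) (t : seq A).

Lemma is_leader_inj f u v : is_leader f u -> is_leader f v -> u = v.
Proof.
by case=> fu le_u [fv le_v]; apply: term_le_anti; [apply: le_v|apply: le_u].
Qed.

Lemma is_leader_lead g : is_leader (C g) (lead g).
Proof. exact: is_leader_scheme. Qed.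

Lemma scheme_not_ground g : ~ ground (C g).
Proof. by move=> /ground_appears; apply; apply: (is_leader_lead g).1. Qed.

Lemma rk_lt_irr f : ~ rk_lt f f.
Proof.
case=> [[] //|[u [v [fu fv]]]]; rewrite (is_leader_inj fu fv).
by case=> [|[_]]; rewrite ?ltnn // /term_lt ltxx.
Qed.

(** All leaders have degree 1, so being reduced means containing no transform of the other leader at
    all. *)
Lemma autoreduced_corners t : t =i [seq C g | g <- corners] ->
  autoreduced (mem t).
Proof.
move=> t_corners.
have t_mem f : (f \in mem t) = (f \in [seq C g | g <- corners]) := t_corners f.
split=> [f|f h].
  by rewrite t_mem => /mapP[g _ ->]; apply: scheme_not_ground.
rewrite !t_mem => /mapP[g gc ->] /mapP[h' hc ->] neq u lead_u.
have {u lead_u}-> := is_leader_inj lead_u (is_leader_lead h').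
have deg1 := degin_scheme c w_lead h'. rewrite deg1 => -[v [m [tr_v Cm m_v]]].
have nz_mv : (m v != 0)%N by rewrite -lt0n.
have [e es v_e] := appears_scheme (ex_intro2 _ _ m Cm nz_mv).
by case: neq; rewrite (corners_reduced gc hc es) // -v_e.
Qed.

(* An element of [J] always contains a transform of some corner leader, and
   reducedness modulo the first [k] elements excludes the first [k] leaders. *)
Lemma autoreduced_transform t k : autoreduced (mem t) -> {subset t <= J} ->
  increasing t -> (k < size t)%N ->
  (forall i, (i < k)%N -> (i < 4)%N ->
    rk_eq (nth 0 t i) (nth 0 [seq C g | g <- corners] i)) ->
  exists j v, [/\ (k <= j < 4)%N, appears v (nth 0 t k) &
    transform (lead (nth 0 corners j)) v].
Proof.
move=> [t_ground t_red] tJ t_incr lt_k t_eq; set f := nth 0 t k.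
have tf : f \in t by rewrite mem_nth.
have nz_f : f != 0.
  by apply/eqP => f0; case: (t_ground f tf); exists 0; rewrite f0 malgC0E.
have [v fv /reducible_transform[g gc tr_v]] :=
  scheme_ideal_reducible w_lead (tJ f tf) nz_f.
have lt_j : (index g corners < 4)%N by rewrite -[4%N]/(size corners) index_mem.
exists (index g corners), v; rewrite nth_index //; split=> //.
rewrite lt_j andbT leqNgt; apply/negP => lt_jk.
set j := index g corners in lt_j lt_jk.
have := t_eq j lt_jk lt_j.
rewrite (nth_map 0) // nth_index // => -[u [tu Cu]].
have {u Cu tu} [-> tu] : u = lead g /\ is_leader (nth 0 t j) (lead g).
  by have u_g := is_leader_inj Cu (is_leader_lead g); rewrite -u_g.
rewrite degin_scheme // => deg1.
have lt_jt : (j < size t)%N by apply: ltn_trans lt_k.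
(* Ranks increase strictly along [t], and no polynomial has lower rank than itself. *)
have neq : f <> nth 0 t j.
  move=> f_j; apply: (@rk_lt_irr f); rewrite {1}f_j.
  by apply: t_incr; rewrite lt_jk.
case: (t_red _ _ tf (mem_nth 0 lt_jt) neq _ tu).
by case: fv => m fm m_v; exists v, m; rewrite deg1 lt0n.
Qed.

(** A competitor agreeing in rank up to position k has there a transform of the leader of some
    corner j >= k. Its own leader is then at least the k-th corner leader, and its degree at least
    1. *)
Lemma characteristic_set_corners t : t =i [seq C g | g <- corners] ->
  characteristic_set J (mem t).
Proof.
move=> t_corners.
have t_mem f : (f \in mem t) = (f \in [seq C g | g <- corners]) := t_corners f.
split; first exact: autoreduced_corners.
  move=> f; rewrite t_mem => /mapP[g _ ->].
  by apply: ideal_generated_incl; exists g.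
exists [seq C g | g <- corners]; split=> [f|i j|s s_red sJ s_incr].
- by rewrite t_mem.
- rewrite size_map => /andP[lt_ij lt_j]; right.
  have lt_i := ltn_trans lt_ij lt_j.
  rewrite !(nth_map 0) //; exists (lead (nth 0 corners i)), (lead (nth 0 corners j)).
  split; [exact: is_leader_lead|exact: is_leader_lead|left].
  by apply: corners_sorted_lt; rewrite lt_ij.
(* A longer competitor would need, at position 4, a corner index j with 4 <= j < 4. *)
rewrite /lower_rank size_map => -[[k [lt_k s_eq rk_k]]|[lt_s s_eq]]; last first.
  have [j [v [/andP[]]]] := autoreduced_transform s_red sJ s_incr lt_s
    (fun i lt_i _ => s_eq i lt_i).
  by move=> /leq_ltn_trans lt_j /lt_j.
move: lt_k; rewrite leq_min => /andP[lt_ks lt_k].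
have [j [v [lt_kj sv tr_v]]] := autoreduced_transform s_red sJ s_incr lt_ks
  (fun i lt_i _ => s_eq i lt_i).
case: rk_k => [[/ground_appears gr _]|[u [u' [su Cu']]]]; first exact: (gr v).
move: Cu'; rewrite (nth_map 0) // => Cu'.
have {u' Cu'}-> := is_leader_inj Cu' (is_leader_lead _).
case=> [|[u_lead]]; last first.
  by rewrite degin_scheme // ltnNge (degin_gt0 su.1).
rewrite term_ltNge => /negP; apply; apply: term_le_trans (corners_sorted lt_kj) _.
by apply: term_le_trans (transform_le tr_v) _; case: su => _; apply.
Qed.

End CharacteristicSet.

Section Automorphisms.
Variables (K : fieldType) (a : automorphism K).

Lemma autz_is_zmod_morphism k : zmod_morphism (autz a k).
Proof.
have iter_sub (f : K -> K) n : zmod_morphism f -> zmod_morphism (iter n f).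
  by move=> fB; elim: n => [|n IHn] x y //; rewrite !iterS -fB -IHn.
case: k => n; apply: iter_sub; first exact: rmorphB.
by apply: can2_zmod_morphism (@autK _ a) (@autVK _ a).
Qed.

Lemma autz_is_monoid_morphism k : monoid_morphism (autz a k).
Proof.
have iter_mul (f : K -> K) n : monoid_morphism f -> monoid_morphism (iter n f).
  move=> [f1 fM]; elim: n => [|n [IH1 IHM]]; first by split.
  by split=> [|x y]; rewrite !iterS ?IH1 ?IHM.
case: k => n; apply: iter_mul; first by split; [exact: rmorph1|exact: rmorphM].
exact: can2_monoid_morphism (@autK _ a) (@autVK _ a).
Qed.

HB.instance Definition _ k := GRing.isZmodMorphism.Build K K (autz a k)
  (autz_is_zmod_morphism k).
HB.instance Definition _ k := GRing.isMonoidMorphism.Build K K (autz a k)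
  (autz_is_monoid_morphism k).

Lemma autz_fixed k x : a x = x -> autz a k x = x.
Proof.
move=> ax; have ax' : autV a x = x by rewrite -{1}ax autK.
by case: k => n; rewrite /autz; [elim: n | elim: n.+1] => //= m ->.
Qed.

End Automorphisms.

Section Action.
Variable K : inversiveDifferenceField.

Definition actK_rmorphism (g : Gamma) : {rmorphism K -> K} :=
  autz (alpha1 K) g.1 \o autz (alpha2 K) g.2.

Lemma actE g : act (K := K) g =
  peval (@malgC _ K \o actK_rmorphism g) (fun v => term K (g + v)).
Proof. by []. Qed.

HB.instance Definition _ g :=
  GRing.RMorphism.copy (act (K := K) g)
    (peval (@malgC _ K \o actK_rmorphism g) (fun v => term K (g + v))).

Lemma actK_constant g x : is_constant x -> actK (K := K) g x = x.
Proof. by case=> x1 x2; rewrite /actK !autz_fixed. Qed.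

Lemma actX g v : act g (indet K v) = indet K (g + v).
Proof. exact: (pevalX (@malgC _ K \o actK_rmorphism g)). Qed.

Lemma actC g (x : K) : is_constant x -> act g (x%:MP) = x%:MP.
Proof.
move=> x_const; rewrite actE pevalC /= -/(actK g x).
by rewrite actK_constant.
Qed.

Lemma actZ g (x : K) f : is_constant x -> act g (x *: f) = x *: act g f.
Proof.
move=> x_const; rewrite actE pevalZ /= -/(actK g x) actK_constant //.
exact: mul_malgC.
Qed.

Variables (w : Gamma -> K) (c : K).
Hypothesis w_const : forall e, is_constant (w e).
Hypothesis c_const : is_constant c.
Local Notation A := (polyring Gamma K).
Local Notation C := (scheme w (c%:MP : A) (@indet Gamma K)).

(** The group fixes the constant coefficients, so it only shifts the terms. *)
Lemma act_scheme g h : act g (C h) = C (g + h).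
Proof.
rewrite /scheme rmorphD rmorph_sum /=; congr (_ + _).
  apply: eq_bigr => e _; rewrite (actZ _ _ (w_const e)) actX addrA.
  by [].
exact: actC.
Qed.

Lemma sigma_ideal_scheme :
  sigma_ideal (C 0) = ideal_generated (fun h : A => exists g, h = C g).
Proof.
congr ideal_generated; apply/funext => h; apply/propext.
by split=> -[g ->]; exists g; rewrite act_scheme addr0.
Qed.

Lemma sigma_closed_scheme :
  sigma_closed (ideal_generated (fun h : A => exists g, h = C g)).
Proof.
move=> g f; elim/ideal_generated_ind: f / => [|f h|a f [g' ->]].
- by rewrite rmorph0 ideal_generated0.
- by rewrite rmorphD; apply: ideal_generatedD.
- rewrite rmorphM; apply/ideal_generatedMl/ideal_generated_incl.
  by exists (g + g'); rewrite -act_scheme.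
Qed.

End Action.

Lemma scheme_stencil (F : fieldType) (A : lmodType F) (w : Gamma -> F) (c : A)
    (Y : Gamma -> A) :
  scheme w c Y 0 = w (1, 1) *: Y (1, 1) + w (-1, 1) *: Y (-1, 1)
    + w (1, 0) *: Y (1, 0) + w (0, 1) *: Y (0, 1) + w (-1, 0) *: Y (-1, 0) + c.
Proof. by rewrite /scheme !big_cons big_nil !add0r addr0 !addrA. Qed.

(** * The Crank-Nicholson scheme *)

Section CrankNicholson.
Variables (K : inversiveDifferenceField) (a1 a2 a3 a4 a5 : K).

Definition cn_weight (e : Gamma) : K :=
  nth 0 [:: 1; a1; a2; a3; a4] (index e stencil).

Lemma crank_nicholsonE : crank_nicholson a1 a2 a3 a4 a5 =
  scheme cn_weight a5%:MP (@indet Gamma K) 0.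
Proof.
rewrite scheme_stencil /crank_nicholson -[term K (1, 1)]scale1r.
reflexivity.
Qed.

(** The offset of the leader is one of four stencil points, according to the quadrant of [g], with
    weights 1, [a1], [a2], [a4]; the point (0, 1) never leads. *)
Lemma cn_weight_lead g : a1 != 0 -> a2 != 0 -> a4 != 0 ->
  cn_weight (lead g - g) != 0.
Proof.
move=> nz1 nz2 nz4; case: g => a b.
have : lead (a, b) - (a, b) \in
    ([:: (1, 1); (-1, 1); (1, 0); (-1, 0)] : seq Gamma).
  by rewrite /lead !inE /eq_op; lia_if.
rewrite !inE => /or4P[]/eqP->; rewrite /cn_weight //=. 
exact: oner_neq0.
Qed.

Lemma cn_weight_constant e : is_constant a1 -> is_constant a2 ->
  is_constant a3 -> is_constant a4 -> is_constant (cn_weight e).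
Proof.
move=> c1 c2 c3 c4; rewrite /cn_weight.
case: (index e stencil) => [|[|[|[|[|n]]]]] //=.
  by split; rewrite rmorph1.
by rewrite nth_nil; split; rewrite rmorph0.
Qed.

End CrankNicholson.

Theorem mainTheorem6 (K : inversiveDifferenceField)
    (charK : [pchar K] =i pred0)
    (a1 a2 a3 a4 a5 : K)
    (a1_const : is_constant a1) (a2_const : is_constant a2) (a3_const : is_constant a3)
    (a4_const : is_constant a4) (a5_const : is_constant a5)
    (a1_neq0 : a1 != 0) (a2_neq0 : a2 != 0) (a4_neq0 : a4 != 0) :
  let C := crank_nicholson a1 a2 a3 a4 a5 in
  sigma_closed (sigma_ideal C) /\
  exists hP : prime_ideal (sigma_ideal C),
    [/\ characteristic_set (sigma_ideal C)
          (mem [:: C; act (-1, 0) C; act (0, -1) C; act (-1, -1) C]),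
        is_leader C (1, 1),
        is_leader (act (-1, 0) C) (-2, 1),
        is_leader (act (0, -1) C) (1, -1) &
        is_leader (act (-1, -1) C) (-2, -1) /\
        dimension_polynomial hP (6%:R *: 'X - 1)].
Proof.
have w_const e := cn_weight_constant e a1_const a2_const a3_const a4_const.
have w_lead g := cn_weight_lead a3 g a1_neq0 a2_neq0 a4_neq0.
move=> C; rewrite {}/C crank_nicholsonE !act_scheme // !addr0 sigma_ideal_scheme //.
split; first exact: sigma_closed_scheme.
exists (scheme_ideal_prime a5 w_lead); split=> [||||].
- have t_corners := map_corners_eqi
    (scheme (cn_weight a1 a2 a3 a4) a5%:MP (@indet Gamma K)).
  exact: (characteristic_set_corners w_lead t_corners).
- exact: (is_leader_lead a5 w_lead (0, 0)).
- exact: (is_leader_lead a5 w_lead (-1, 0)).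
- exact: (is_leader_lead a5 w_lead (0, -1)).
split; first exact: (is_leader_lead a5 w_lead (-1, -1)).
(* From r = 1 on, the truncated subtraction agrees with the value of the rational polynomial. *)
exists 1%N => r r_gt0; exists (6 * r - 1)%N.
  exact: (trdeg_scheme w_lead (to_quotient_field_eq0 _)).
rewrite hornerD hornerN hornerZ hornerX hornerC.
by rewrite natrB ?natrM // muln_gt0.
Qed.
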